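(* Let $n\geq 5$ and $0\leq g\leq n-3$ be integers, let $f_n(g)=n(g+1)-\frac{g(g+3)}{2}$, and let $X_n\in\mathbb{L}_n$ be an $n$-dimensional HL-network. If $X_n$ has a connected subgraph $A$ such that $|V(A)|=g+1$ and $|N_{X_n}(A)|=f_n(g)$, then $\kappa_g(X_n)=f_n(g)$.
   Context: All graphs are finite, simple, undirected. HL-networks are defined recursively: $\mathbb{L}_0=\{K_1\}$, and for $n\ge 1$, $\mathbb{L}_n=\{G_0\oplus G_1 \mid G_0,G_1\in \mathbb{L}_{n-1}\}$, where $G_0\oplus G_1$ denotes any graph obtained from vertex-disjoint copies of $G_0$ and $G_1$ by adding the edges of some perfect matching between $V(G_0)$ and $V(G_1)$ (each vertex of $G_0$ is matched to exactly one vertex of $G_1$ and vice versa). A graph in $\mathbb{L}_n$ is called an $n$-dimensional HL-network. For a subgraph $A$ of $X_n$, $N_{X_n}(A)$ denotes the set of vertices of $X_n$ not in $V(A)$ that are adjacent in $X_n$ to at least one vertex of $V(A)$. For a connected graph $G$ and an integer $g\ge 0$, a set $S$ of vertices is a cutset if $G-S$ is not connected; a cutset $S$ is an $R_g$-cutset if every connected component of $G-S$ has at least $g+1$ vertices. If $G$ has at least one $R_g$-cutset, the $g$-extra connectivity $\kappa_g(G)$ is the minimum cardinality of an $R_g$-cutset of $G$. *)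

(* Defs.v *)
From HB Require Import structures.
From mathcomp Require Import all_boot.

Set Implicit Arguments.
Unset Strict Implicit.
Unset Printing Implicit Defensive.

Record sgraph := SGraph {
  vertex :> finType;
  adj : rel vertex;
  adj_sym : symmetric adj;
  adj_irrefl : irreflexive adj }.

Definition isomorphic (G H : sgraph) : Prop :=
  exists2 h : G -> H, bijective h & forall x y, adj (h x) (h y) = adj x y.

(* The empty graph counts as connected, so V(G) is never a cutset of G. *)
Definition connected (G : sgraph) : bool :=
  [forall x : G, forall y : G, connect (@adj G) x y].

Definition components (G : sgraph) : {set {set G}} :=
  [set [set y | connect (@adj G) x y] | x : G].

Record subgraph (G : sgraph) := Subgraph {
  sub_verts : {set G};
  sub_adj : rel G;
  sub_adj_sym : symmetric sub_adj;
  sub_adjP : forall x y, sub_adj x y ->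
    [&& x \in sub_verts, y \in sub_verts & adj x y] }.

Section SubgraphGraph.
Variables (G : sgraph) (A : subgraph G).

Definition subgraph_adj : rel {x : G | x \in sub_verts A} :=
  fun x y => sub_adj A (val x) (val y).

Fact subgraph_adj_sym : symmetric subgraph_adj.
Proof. by move=> x y; exact: sub_adj_sym. Qed.

Fact subgraph_adj_irrefl : irreflexive subgraph_adj.
Proof.
move=> x; apply/negP => /sub_adjP /and3P[_ _].
by rewrite adj_irrefl.
Qed.

Definition subgraph_graph : sgraph :=
  SGraph subgraph_adj_sym subgraph_adj_irrefl.
End SubgraphGraph.

Definition nbhd (G : sgraph) (A : subgraph G) : {set G} :=
  [set x | (x \notin sub_verts A) && [exists y in sub_verts A, adj x y]].

Section DeleteVertices.
Variables (G : sgraph) (S : {set G}).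

Definition del_adj : rel {x : G | x \notin S} :=
  fun x y => adj (val x) (val y).

Fact del_adj_sym : symmetric del_adj.
Proof. by move=> x y; exact: adj_sym. Qed.

Fact del_adj_irrefl : irreflexive del_adj.
Proof. by move=> x; exact: adj_irrefl. Qed.

Definition del_verts : sgraph := SGraph del_adj_sym del_adj_irrefl.
End DeleteVertices.

Definition perfect_matching (T0 T1 : finType) (M : T0 -> T1 -> bool) : Prop :=
  (forall x, #|[set y | M x y]| = 1) /\ (forall y, #|[set x | M x y]| = 1).

Section Oplus.
Variables (G0 G1 : sgraph) (M : G0 -> G1 -> bool).

Definition oplus_adj : rel (G0 + G1)%type := fun u v =>
  match u, v with
  | inl x, inl y => adj x y
  | inr x, inr y => adj x y
  | inl x, inr y => M x y
  | inr y, inl x => M x y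
  end.

Fact oplus_adj_sym : symmetric oplus_adj.
Proof. by case=> x [] y //=; exact: adj_sym. Qed.

Fact oplus_adj_irrefl : irreflexive oplus_adj.
Proof. by case=> x /=; exact: adj_irrefl. Qed.

Definition oplus : sgraph := SGraph oplus_adj_sym oplus_adj_irrefl.
End Oplus.

(* Membership of G in L_n, up to isomorphism; a graph with one vertex is K_1
   by irreflexivity. *)
Fixpoint HL_network (n : nat) (G : sgraph) : Prop :=
  match n with
  | 0 => #|G| = 1
  | m.+1 => exists (G0 G1 : sgraph) (M : G0 -> G1 -> bool),
      [/\ HL_network m G0, HL_network m G1, perfect_matching M
        & isomorphic G (oplus M)]
  end.

Definition cutset (G : sgraph) (S : {set G}) : bool :=
  ~~ connected (del_verts S).

Definition Rg_cutset (g : nat) (G : sgraph) (S : {set G}) : bool :=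
  cutset S && [forall C in components (del_verts S), g + 1 <= #|C|].

(* None when undefined: G is disconnected or has no R_g-cutset. *)
Definition extra_connectivity (g : nat) (G : sgraph) : option nat :=
  if connected G then
    if [pick S : {set G} | Rg_cutset g S] is Some S0
    then Some #|[arg min_(S < S0 | Rg_cutset g S) #|S|]|
    else None
  else None.

(* g * (g + 3) is even, so the halving is exact; for g <= n the truncated
   subtraction is the integer one. *)
Definition f (n g : nat) : nat := n * (g + 1) - (g * (g + 3))./2.

(* Main.v *)
Require Import Defs.
From mathcomp Require Import all_boot zify.

(** Write [F n m = 1 + m * n - 'C(m, 2)], so that [f n g = F n g.+1 - g.+1];
    [F n m] is the number of vertices in the closed neighbourhood of a star with
    [m <= n + 1] vertices in the [n]-cube. Splitting an [n.+1]-dimensional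
    network into two halves and inducting shows that every set of [m > 0] vertices has a
    closed neighbourhood of at least [F n m] vertices
    ([vertex_isoperimetry]); the induction works because
    [F n a + F n b - F n.+1 (a + b) = (a - 1) * (b - 1)] and because a set
    lying in one half has a full copy of itself across the matching. The
    function [m |-> F n m - m] is concave and symmetric about [n - 1/2]; its
    values at [m = n - 2] and at [m = n + 1] are both ['C(n, 2)].

    This bound is only useful for sets that are not too large. A second
    induction ([small_separation]) provides the size control: deleting at most
    ['C(n, 2)] vertices cannot split the network into two mutually
    nonadjacent parts with more than [n + 1] vertices each. When no half loses
    ['C(n - 1, 2)] vertices, each half has one giant part; the giants lie on
    the same side, since the matching between them is too large to be cut, and
    isoperimetry in the halves finishes. Otherwise the other half loses so
    few vertices that one of the two parts has at most one vertex there, and the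
    rest of that part is matched into this vertex and the few deleted ones.

    Lower bound: an R_g-cutset [S] separates two parts with more than [g]
    vertices each. If [#|S| <= 'C(n, 2)], one part has size [k] with
    [g < k <= n + 1], and concavity and symmetry give
    [#|S| >= F n k - k >= f n g].

    Upper bound: [N(A)] is itself an R_g-cutset. Suppose that deleting it
    leaves a component [D] with at most [g] vertices. Then [A :|: D] is cut off
    by [f n g <= 'C(n, 2)] vertices, so it has at most [n + 1] vertices, and
    more than [g + 1]. The isoperimetric bound exceeds [f n g] there, except
    when [g = n - 3] and [#|A :|: D| = n + 1], where it equals [f n g]. But a
    set of [n + 1] vertices attaining the bound cannot be a union of two
    nonadjacent parts ([vertex_isoperimetry_detached]). *)

Set Implicit Arguments.
Unset Strict Implicit.
Unset Printing Implicit Defensive.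

(** * The two halves of a network *)

(** The edges inside the halves and the matching edges, seen from both sides,
    are only required to be present in [G]: every estimate below is a lower
    bound on neighbourhoods. Sets of [G] are handled through their preimages in
    the halves, so that isomorphisms never need to be transported, and the
    record is symmetric in the two halves. *)
Record halving (G G0 G1 : sgraph) := Halving {
  half0 : G0 -> G;
  half1 : G1 -> G;
  cross0 : G0 -> G1;
  cross1 : G1 -> G0;
  card_halves : forall B : {set G},
    #|B| = #|half0 @^-1: B| + #|half1 @^-1: B|;
  half0_adj : forall x y, adj x y -> adj (half0 x) (half0 y);
  half1_adj : forall x y, adj x y -> adj (half1 x) (half1 y);
  cross0_inj : injective cross0;
  cross1_inj : injective cross1;
  cross0_adj : forall x, adj (half0 x) (half1 (cross0 x));
  cross1_adj : forall y, adj (half1 y) (half0 (cross1 y)) }.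

Definition halving_sym G G0 G1 (H : halving G G0 G1) : halving G G1 G0 :=
  Halving (fun B => etrans (card_halves H B) (addnC _ _))
    (@half1_adj _ _ _ H) (@half0_adj _ _ _ H)
    (@cross1_inj _ _ _ H) (@cross0_inj _ _ _ H)
    (@cross1_adj _ _ _ H) (@cross0_adj _ _ _ H).

Lemma perfect_matchingP (T0 T1 : finType) (M : T0 -> T1 -> bool) :
  perfect_matching M ->
  exists c0 c1, [/\ injective c0, injective c1,
    forall x, M x (c0 x) & forall y, M (c1 y) y].
Proof.
case=> M0 M1.
have ex0 x : exists y, M x y.
  by have /eqP/cards1P[y /setP/(_ y)] := M0 x; rewrite !inE eqxx; exists y.
have ex1 y : exists x, M x y.
  by have /eqP/cards1P[x /setP/(_ x)] := M1 y; rewrite !inE eqxx; exists x.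
exists (fun x => xchoose (ex0 x)), (fun y => xchoose (ex1 y)).
split=> [x x' /= exx'|y y' /= eyy'|x|y].
- have /eqP/cards1P[z /setP Ez] := M1 (xchoose (ex0 x)).
  have Mx := xchooseP (ex0 x); have Mx' := xchooseP (ex0 x').
  rewrite -exx' in Mx'; have := Ez x; have := Ez x'.
  by rewrite !inE Mx Mx' => /esym/eqP -> /esym/eqP ->.
- have /eqP/cards1P[z /setP Ez] := M0 (xchoose (ex1 y)).
  have My := xchooseP (ex1 y); have My' := xchooseP (ex1 y').
  rewrite -eyy' in My'; have := Ez y; have := Ez y'.
  by rewrite !inE My My' => /esym/eqP -> /esym/eqP ->.
- exact: xchooseP (ex0 x).
- exact: xchooseP (ex1 y).
Qed.

Lemma card_sum_preim (T0 T1 : finType) (B : {set T0 + T1}) :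
  #|B| = #|inl @^-1: B| + #|inr @^-1: B|.
Proof.
rewrite -!sum1_card big_sumType /=.
by congr (_ + _); apply: eq_bigl => x; rewrite inE.
Qed.

Lemma HL_halving n (G : sgraph) : HL_network n.+1 G ->
  exists G0 G1 (_ : halving G G0 G1), HL_network n G0 /\ HL_network n G1.
Proof.
move=> /= [G0 [G1 [M [HG0 HG1 /perfect_matchingP[c0 [c1 [i0 i1 e0 e1]]]]]]].
case=> h [k hK kK] h_adj.
have k_adj u v : adj (k u) (k v) = oplus_adj M u v by rewrite -h_adj !kK.
exists G0, G1; unshelve eexists; last by [].
exists (k \o inl) (k \o inr) c0 c1 => //=.
- move=> B; have <- : #|k @^-1: B| = #|B|.
    by rewrite on_card_preimset //; exists h => x _; [exact: kK | exact: hK].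
  rewrite card_sum_preim.
  by congr (_ + _); apply: eq_card => x; rewrite !inE.
- by move=> x y; rewrite k_adj.
- by move=> x y; rewrite k_adj.
- by move=> x; rewrite k_adj /=.
- by move=> y; rewrite k_adj /=.
Qed.

Lemma card_HL n (G : sgraph) : HL_network n G -> #|G| = 2 ^ n.
Proof.
elim: n G => [|n IH] G; first by rewrite expn0.
case/HL_halving => G0 [G1 [H [/IH E0 /IH E1]]].
by rewrite -cardsT (card_halves H) !preimsetT !cardsT E0 E1 addnn expnS mul2n.
Qed.

(** * Isoperimetry *)

Lemma bin2D a b : 'C(a + b, 2) = 'C(a, 2) + 'C(b, 2) + a * b.
Proof.
elim: b => [|b IH]; first by rewrite !addn0 muln0 addn0.
rewrite addnS !binS IH !bin1 mulnS; lia.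
Qed.

Lemma bin2_double m : 'C(m, 2).*2 + m = m * m.
Proof. by elim: m => // m IH; rewrite binS bin1; nia. Qed.

Definition closed_nbhd (G : sgraph) (B : {set G}) : {set G} :=
  [set x | (x \in B) || [exists y in B, adj x y]].

Lemma closed_nbhdP (G : sgraph) (B : {set G}) x y :
  y \in B -> adj x y -> x \in closed_nbhd B.
Proof.
by move=> yB xy; rewrite inE; apply/orP; right; apply/existsP; exists y; rewrite yB.
Qed.

Lemma sub_closed_nbhd (G : sgraph) (B : {set G}) : B \subset closed_nbhd B.
Proof. by apply/subsetP => x xB; rewrite inE xB. Qed.

Lemma closed_nbhd_half0 G G0 G1 (H : halving G G0 G1) (B : {set G}) :
  closed_nbhd (half0 H @^-1: B) \subset half0 H @^-1: closed_nbhd B.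
Proof.
apply/subsetP => x; rewrite !inE => /orP[->//|/exists_inP[y]].
rewrite inE => yB xy; apply/orP; right; apply/exists_inP.
by exists (half0 H y) => //; exact: half0_adj.
Qed.

Lemma closed_nbhd_cross1 G G0 G1 (H : halving G G0 G1) (B : {set G}) :
  cross1 H @: (half1 H @^-1: B) \subset half0 H @^-1: closed_nbhd B.
Proof.
apply/subsetP => _ /imsetP[y yB ->]; rewrite inE in yB.
by rewrite inE (closed_nbhdP yB) // adj_sym cross1_adj.
Qed.

Lemma card_closed_nbhd_half0 G G0 G1 (H : halving G G0 G1) (B : {set G}) :
  #|closed_nbhd (half0 H @^-1: B)| <= #|half0 H @^-1: closed_nbhd B| /\
  #|half1 H @^-1: B| <= #|half0 H @^-1: closed_nbhd B|.
Proof.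
split; first exact: subset_leq_card (closed_nbhd_half0 H B).
rewrite -(card_imset _ (@cross1_inj _ _ _ H)).
exact: subset_leq_card (closed_nbhd_cross1 H B).
Qed.

Lemma card_closed_nbhd_half1 G G0 G1 (H : halving G G0 G1) (B : {set G}) :
  #|closed_nbhd (half1 H @^-1: B)| <= #|half1 H @^-1: closed_nbhd B| /\
  #|half0 H @^-1: B| <= #|half1 H @^-1: closed_nbhd B|.
Proof. exact: card_closed_nbhd_half0 (halving_sym H) B. Qed.

(** In the inductive step, let [b0] and [b1] be the sizes of the two parts of
    [B]. If one is empty, its half still receives the matched copy of the other
    part; if both are nonempty, the two bounds add up with [(b0 - 1) * (b1 - 1)]
    to spare. The binomial coefficient is kept on the right-hand side, so the
    bound holds for large [B] too, even where [1 + #|B| * n - 'C(#|B|, 2)] is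
    negative. *)
Lemma vertex_isoperimetry n (G : sgraph) (B : {set G}) : HL_network n G ->
  0 < #|B| -> #|B| * n < #|closed_nbhd B| + 'C(#|B|, 2).
Proof.
elim: n G B => [|n IH] G B HG B0.
  rewrite muln0 addn_gt0 (leq_trans B0) //.
  exact: subset_leq_card (sub_closed_nbhd B).
have [G0 [G1 [H [H0 H1]]]] := HL_halving HG.
have [N0 X0] := card_closed_nbhd_half0 H B.
have [N1 X1] := card_closed_nbhd_half1 H B.
rewrite (card_halves H (closed_nbhd B)).
have := IH _ (half0 H @^-1: B) H0; have := IH _ (half1 H @^-1: B) H1.
move: B0; rewrite (card_halves H B) bin2D.
move: N0 X0 N1 X1.
move: #|_| => N0; move: #|_| => M0; move: #|_| => b1.
move: #|_| => N1; move: #|_| => M1; move: #|_| => b0.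
move=> N0M0 b1M0 N1M1 b0M1 b0b1.
case: (posnP b0) => [b00 I1 _|b0_gt0].
  subst b0; rewrite !add0n mul0n addn0 in b0b1 *.
  have := I1 b0b1; nia.
case: (posnP b1) => [b10 _ /(_ isT) I0|b1_gt0 /(_ isT) I1 /(_ isT) I0].
  subst b1; rewrite !addn0 muln0 addn0 in b0b1 *.
  have := I0; nia.
nia.
Qed.

(** * Separations *)

Definition detached (G : sgraph) (B C : {set G}) :=
  forall x y, x \in B -> y \in C -> (x != y) && ~~ adj x y.

Lemma detached_sym (G : sgraph) (B C : {set G}) :
  detached B C -> detached C B.
Proof. by move=> BC x y xC yB; rewrite eq_sym adj_sym; exact: BC. Qed.

Lemma detached_disjoint (G : sgraph) (B C : {set G}) :
  detached B C -> B :&: C = set0.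
Proof.
move=> BC; apply/setP => x; rewrite !inE; apply/negP => /andP[xB xC].
by have := BC _ _ xB xC; rewrite eqxx.
Qed.

Lemma detached_cardU (G : sgraph) (B C : {set G}) :
  detached B C -> #|B :|: C| = #|B| + #|C|.
Proof. by move=> BC; rewrite cardsU detached_disjoint // cards0 subn0. Qed.

Lemma detached_half0 G G0 G1 (H : halving G G0 G1) (B C : {set G}) :
  detached B C -> detached (half0 H @^-1: B) (half0 H @^-1: C).
Proof.
move=> BC x y; rewrite !inE => xB yC; have /andP[xy nadj] := BC _ _ xB yC.
rewrite (contra_neq _ xy) => [|->//].
by apply: contra nadj; exact: half0_adj.
Qed.

Lemma detached_half1 G G0 G1 (H : halving G G0 G1) (B C : {set G}) :
  detached B C -> detached (half1 H @^-1: B) (half1 H @^-1: C).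
Proof. exact: (@detached_half0 _ _ _ (halving_sym H)). Qed.

(** A matching edge never joins two detached sets. *)
Lemma card_cross0_detached G G0 G1 (H : halving G G0 G1) (B C : {set G}) :
  detached B C ->
  #|cross0 H @: (half0 H @^-1: B) :|: half1 H @^-1: C| =
    #|half0 H @^-1: B| + #|half1 H @^-1: C|.
Proof.
move=> BC; rewrite cardsU (card_imset _ (@cross0_inj _ _ _ H)).
suff -> : cross0 H @: (half0 H @^-1: B) :&: half1 H @^-1: C = set0.
  by rewrite cards0 subn0.
apply/setP => y; rewrite in_setI in_set0; apply/negP.
case/andP => /imsetP[x + ->]; rewrite !inE => xB yC.
by have := BC _ _ xB yC; rewrite cross0_adj andbF.
Qed.

(** The isoperimetric bound is strict on a disconnected set with more than [n]
    vertices. Tightness survives the induction only if one half meets the set in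
    at most one vertex. If that vertex [y] is all of [D], the matched copy of [A]
    misses [y], so that half contains one vertex more than expected; otherwise
    [A] and [D] both still meet the other half. The bound [n < #|A :|: D|] is
    sharp: two vertices of a 4-cycle at distance 2 attain equality for
    [n = 2]. *)
Lemma vertex_isoperimetry_detached n (G : sgraph) (A D : {set G}) :
  HL_network n G -> detached A D -> 0 < #|A| -> 0 < #|D| ->
  n < #|A :|: D| ->
  (#|A :|: D| * n).+1 < #|closed_nbhd (A :|: D)| + 'C(#|A :|: D|, 2).
Proof.
elim: n G A D => [|n IH] G A D HG AD A0 D0.
  by have := max_card (A :|: D); rewrite (detached_cardU AD) (card_HL HG); lia.
have [G0 [G1 [H [H0 H1]]]] := HL_halving HG.
wlog le_b : G0 G1 H H0 H1 /
    #|half1 H @^-1: (A :|: D)| <= #|half0 H @^-1: (A :|: D)|.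
  move=> W; case: (leqP #|half1 H @^-1: (A :|: D)| #|half0 H @^-1: (A :|: D)|).
    exact: W.
  by move/ltnW; apply: (W _ _ (halving_sym H)).
wlog le_ad : A D AD A0 D0 le_b /
    #|half1 H @^-1: A| <= #|half1 H @^-1: D|.
  move=> W; case: (leqP #|half1 H @^-1: A| #|half1 H @^-1: D|); first exact: W.
  by move/ltnW; move: le_b; rewrite setUC; apply: W => //; exact: detached_sym.
have AD0 := detached_half0 (H := H) AD; have AD1 := detached_half1 (H := H) AD.
have E0 := detached_cardU AD0; have E1 := detached_cardU AD1.
rewrite -!preimsetU in E0 E1.
have [N0 X0] := card_closed_nbhd_half0 H (A :|: D).
have [N1 X1] := card_closed_nbhd_half1 H (A :|: D).
have I0 := vertex_isoperimetry (B := half0 H @^-1: (A :|: D)) H0.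
have I1 := vertex_isoperimetry (B := half1 H @^-1: (A :|: D)) H1.
have J0 := IH _ _ _ H0 AD0; rewrite -!preimsetU in J0.
have X1' : #|half0 H @^-1: A| + #|half1 H @^-1: D| <=
      #|half1 H @^-1: closed_nbhd (A :|: D)|.
  rewrite -(card_cross0_detached H AD).
  apply: subset_leq_card; apply/subsetP => y.
  case/setUP => [/imsetP[x xA ->]|yD]; last by rewrite !inE in yD *; rewrite yD orbT.
  rewrite inE (closed_nbhdP (y := half0 H x)) //; first by rewrite !inE in xA *; rewrite xA.
  by rewrite adj_sym cross0_adj.
move: A0 D0; rewrite (card_halves H A) (card_halves H D).
rewrite (card_halves H (A :|: D)) (card_halves H (closed_nbhd (A :|: D))) bin2D.
move: E0 E1 N0 X0 N1 X1 I0 I1 J0 X1' le_b le_ad.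
move: #|half0 H @^-1: (A :|: D)| #|half1 H @^-1: (A :|: D)| => b0 b1.
move: #|half0 H @^-1: A| #|half1 H @^-1: A| => a0 a1.
move: #|half0 H @^-1: D| #|half1 H @^-1: D| => d0 d1.
move: #|half0 H @^-1: closed_nbhd _| #|half1 H @^-1: closed_nbhd _| => M0 M1.
move: #|_| #|_| => N1 N0.
move=> E0 E1 N0M0 b1M0 N1M1 b0M1 I0 I1 J0 X1 leb lead a_gt0 d_gt0 ltn.
case: (posnP b1) => [b10|b1_gt0].
  have J : (b0 * n).+1 < N0 + 'C(b0, 2) by apply: J0; lia.
  by rewrite b10 bin0n !addn0 muln0 addn0 mulnS; lia.
have {I0} I0 : b0 * n < N0 + 'C(b0, 2) by apply: I0; lia.
have {I1} I1 : b1 * n < N1 + 'C(b1, 2) by apply: I1; lia.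
case: (ltnP 1 b1) => [b1_gt1|b1_le1].
  have prod_ge : b0 + b1 <= b0 * b1 by nia.
  by rewrite mulnDl !mulnS; lia.
have b11 : b1 = 1 by lia.
have a10 : a1 = 0 by lia.
have d11 : d1 = 1 by lia.
rewrite b11 (_ : 'C(1, 2) = 0) // mulnDl !mulnS.
case: (posnP d0) => [d00|d0_gt0].
  lia.
have J : (b0 * n).+1 < N0 + 'C(b0, 2) by apply: J0; lia.
lia.
Qed.

Lemma card_separation (G : sgraph) (B C : {set G}) : detached B C ->
  #|B| + #|C| + #|~: (B :|: C)| = #|G|.
Proof. by move=> BC; rewrite -(detached_cardU BC) cardsC. Qed.

Lemma detached_closed_nbhd (G : sgraph) (B C : {set G}) : detached B C ->
  #|closed_nbhd B| <= #|B| + #|~: (B :|: C)|.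
Proof.
move=> BC; have cardG := card_separation BC.
suff /subset_leq_card : closed_nbhd B \subset ~: C by have := cardsC C; lia.
apply/subsetP => x; rewrite !inE => /orP xN; apply/negP => xC.
case: xN => [xB|/exists_inP[y yB xy]].
  by have := BC _ _ xB xC; rewrite eqxx.
by have := BC _ _ yB xC; rewrite adj_sym xy andbF.
Qed.

Lemma detached_isoperimetry n (G : sgraph) (B C : {set G}) : HL_network n G ->
  detached B C -> 0 < #|B| ->
  #|B| * n < #|B| + #|~: (B :|: C)| + 'C(#|B|, 2).
Proof.
move=> HG BC B0; have := vertex_isoperimetry HG B0.
have := detached_closed_nbhd BC; lia.
Qed.

(** * Small separators *)

(** Giant parts on opposite sides of the separation would leave a matching of
    about [2 ^ p] edges to be cut. *)
Lemma expn2_gt_bin2 p : 2 < p -> 'C(p.+1, 2) + 2 * p < 2 ^ p + 6.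
Proof.
elim: p => // p IH; rewrite ltnS leq_eqVlt => /orP[/eqP <- //|/[dup] p2 /IH].
by rewrite expnS (binS p.+1) bin1; have := bin2_double p.+1; nia.
Qed.

(** The bound [b * (p - 1) + 1 - 'C(b, 2)] on a separator is concave in [b]
    and equals ['C(p, 2)] at both [b = p - 2] and [b = p + 1]. *)
Lemma isoperimetric_gap p b s : 2 < p -> b <= p.+1 -> s < 'C(p, 2) ->
  (0 < b -> b * p < b + s + 'C(b, 2)) -> b + 3 <= p.
Proof.
move=> p_gt2 b_le s_lt iso; rewrite leqNgt; apply/negP => b_gt.
have {}iso : b * p < b + s + 'C(b, 2) by apply: iso; lia.
have Ep := bin2_double p; have Eb := bin2_double b.
(* Only the four values of [b] from [p - 2] to [p + 1] remain. *)
have [k Ek] : exists k, b + 2 = p + k by exists (b + 2 - p); lia.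
have k_le3 : k <= 3 by lia.
have {b_le b_gt} : p = b + 2 - k by lia.
by case: k Ek k_le3 => [|[|[|[|//]]]] _ _ ?; subst p; nia.
Qed.

(** Small parts of size at most [p - 3] that together exceed [p + 2] force
    [p >= 9], and then the two separators are far too large. *)
Lemma same_side_arith p b0 b1 s0 s1 : b0 + 3 <= p -> b1 + 3 <= p ->
  p + 2 < b0 + b1 ->
  (0 < b0 -> b0 * p < b0 + s0 + 'C(b0, 2)) ->
  (0 < b1 -> b1 * p < b1 + s1 + 'C(b1, 2)) ->
  'C(p.+1, 2) < s0 + s1.
Proof.
move=> b0_le b1_le b_gt I0 I1.
have {}I0 : b0 * p < b0 + s0 + 'C(b0, 2) by apply: I0; lia.
have {}I1 : b1 * p < b1 + s1 + 'C(b1, 2) by apply: I1; lia.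
have E0 := bin2_double b0; have E1 := bin2_double b1.
have Ep := bin2_double p.+1.
(* Slack variables make the final inequality one with nonnegative coefficients. *)
have [x Ex] : exists x, p = b0 + 3 + x by exists (p - (b0 + 3)); lia.
have [y Ey] : exists y, p = b1 + 3 + y by exists (p - (b1 + 3)); lia.
have [z Ez] : exists z, p = 9 + x + y + z by exists (p - (9 + x + y)); lia.
have {}Ex : b0 = 6 + y + z by lia.
have {}Ey : b1 = 6 + x + z by lia.
subst; nia.
Qed.

Lemma singleton_arith p b s : b + 3 <= p -> s <= p ->
  (0 < b -> b * p < b + s + 'C(b, 2)) -> b <= 1.
Proof.
move=> b_le s_le iso; rewrite leqNgt; apply/negP => b_gt1.
have {}iso : b * p < b + s + 'C(b, 2) by apply: iso; lia.
by have := bin2_double b; nia.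
Qed.

(** The counting behind [small_separation]: [b0], [c0], [s0] and [b1], [c1], [s1]
    are the sizes of the two parts and of the separator in each half. *)
Lemma separation_arith p b0 b1 c0 c1 s0 s1 : 2 < p ->
  b0 + c0 + s0 = 2 ^ p -> b1 + c1 + s1 = 2 ^ p ->
  b0 + c1 <= 2 ^ p -> b1 + c0 <= 2 ^ p ->
  (s0 < 'C(p, 2) -> b0 + 3 <= p \/ c0 + 3 <= p) ->
  (s1 < 'C(p, 2) -> b1 + 3 <= p \/ c1 + 3 <= p) ->
  (0 < b0 -> b0 * p < b0 + s0 + 'C(b0, 2)) ->
  (0 < b1 -> b1 * p < b1 + s1 + 'C(b1, 2)) ->
  (0 < c0 -> c0 * p < c0 + s0 + 'C(c0, 2)) ->
  (0 < c1 -> c1 * p < c1 + s1 + 'C(c1, 2)) ->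
  p + 2 < b0 + b1 -> p + 2 < c0 + c1 -> 'C(p.+1, 2) < s0 + s1.
Proof.
move=> p_gt2.
wlog s_le : b0 b1 c0 c1 s0 s1 / s1 <= s0.
  move=> W; case: (leqP s1 s0) => [|/ltnW] s_le; first exact: W.
  move=> *; rewrite addnC.
  by apply: (W b1 b0 c1 c0) => //; rewrite [_ + b0]addnC || rewrite [_ + c0]addnC.
move=> E0 E1 X01 X10 R0 R1 Ib0 Ib1 Ic0 Ic1 b_gt c_gt.
have pow_gt := expn2_gt_bin2 p_gt2.
rewrite ltnNge; apply/negP => s_small.
case: (ltnP s0 'C(p, 2)) => [s0_lt|s0_ge].
  have s1_lt : s1 < 'C(p, 2) by lia.
  (* The middle two cases have the giant parts on opposite sides. *)
  case: (R0 s0_lt) => k0; case: (R1 s1_lt) => k1.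
  - have := same_side_arith k0 k1 b_gt Ib0 Ib1; lia.
  - lia.
  - lia.
  - have := same_side_arith k0 k1 c_gt Ic0 Ic1; lia.
(* The half with [s1] deleted vertices has lost at most [p] of them. *)
have Ebin : 'C(p.+1, 2) = 'C(p, 2) + p by rewrite binS bin1 addnC.
have Ep := bin2_double p.
have s1_le : s1 <= p by lia.
have s1_lt : s1 < 'C(p, 2).
  case: (ltnP 3 p) => [p_gt3|p_le3].
    have sq_ge : 4 * p <= p * p by rewrite leq_mul2r p_gt3 orbT.
    lia.
  (* The whole network has 16 vertices and each part more than 5. *)
  have p3 : p = 3 by lia.
  have pow3 : 2 ^ p = 8 by rewrite p3.
  have bin3 : 'C(p, 2) = 3 by rewrite p3.
  lia.
case: (R1 s1_lt) => k1;
  [have := singleton_arith k1 s1_le Ib1 | have := singleton_arith k1 s1_le Ic1]; lia.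
Qed.

Lemma cross_halves G G0 G1 (H : halving G G0 G1) (B C : {set G}) :
  detached B C -> #|half0 H @^-1: B| + #|half1 H @^-1: C| <= #|G1|.
Proof. by move=> BC; rewrite -card_cross0_detached // max_card. Qed.

(** The threshold [n + 1] is the size of a ball of radius 1 in the [n]-cube,
    which is cut off by exactly ['C(n, 2)] vertices. Below dimension 4 there are
    not enough vertices for two parts of that size. *)
Lemma small_separation n (G : sgraph) (B C : {set G}) : HL_network n G ->
  detached B C -> n.+1 < #|B| -> n.+1 < #|C| ->
  'C(n, 2) < #|~: (B :|: C)|.
Proof.
elim: n G B C => [|p IH] G B C HG BC.
  by have := card_separation BC; rewrite (card_HL HG) expn0; lia.
case: (leqP p 2) => [p_le2|p_gt2].
  have := card_separation BC; rewrite (card_HL HG).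
  by case: p {IH HG} p_le2 => [|[|[|//]]] _; rewrite ?expnS /=; lia.
have [G0 [G1 [H [H0 H1]]]] := HL_halving HG.
have BC0 := detached_half0 (H := H) BC; have BC1 := detached_half1 (H := H) BC.
have CB := detached_sym BC; have CB0 := detached_sym BC0.
have CB1 := detached_sym BC1.
have := card_separation BC0; have := card_separation BC1.
have := cross_halves H BC; have := cross_halves H CB.
have := detached_isoperimetry H0 BC0; have := detached_isoperimetry H0 CB0.
have := detached_isoperimetry H1 BC1; have := detached_isoperimetry H1 CB1.
rewrite ![_ @^-1: C :|: _]setUC.
have := IH _ _ _ H0 BC0; have := IH _ _ _ H1 BC1.
rewrite (card_HL H0) (card_HL H1) (card_halves H B) (card_halves H C).
rewrite (card_halves H (~: _)) !preimsetC !preimsetU.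
move: #|half0 H @^-1: B| #|half1 H @^-1: B| => b0 b1.
move: #|half0 H @^-1: C| #|half1 H @^-1: C| => c0 c1.
move: #|_| #|_| => s0 s1.
move=> R1 R0 Ic1 Ib1 Ic0 Ib0 X10 X01 E1 E0 b_gt c_gt.
have gap b c s : (p.+1 < b -> p.+1 < c -> 'C(p, 2) < s) ->
    (0 < b -> b * p < b + s + 'C(b, 2)) ->
    (0 < c -> c * p < c + s + 'C(c, 2)) ->
    s < 'C(p, 2) -> b + 3 <= p \/ c + 3 <= p.
  move=> R Ib Ic s_lt; case: (leqP b p.+1) => [b_le|b_gt'].
    by left; exact: isoperimetric_gap Ib.
  case: (leqP c p.+1) => [c_le|c_gt']; first by right; exact: isoperimetric_gap Ic.
  by have := R b_gt' c_gt'; lia.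
apply: (@separation_arith p b0 b1 c0 c1) => //;
  [by rewrite addnC|exact: gap|exact: gap|by rewrite addn2|by rewrite addn2].
Qed.

(** * Estimates for the extra connectivity *)

Lemma fE n g : g <= n -> f n g + (g.+1 + 'C(g.+1, 2)) = 1 + g.+1 * n.
Proof.
move=> g_le; have Eg := bin2_double g.+1.
have half_f : (g * (g + 3))./2 = 'C(g.+1, 2) + g.
  by rewrite -[RHS]doubleK; congr _./2; rewrite doubleD; nia.
have f_ge : 'C(g.+1, 2) + g <= n * g.+1 by nia.
rewrite /f half_f addn1; nia.
Qed.

Lemma f_le_bin2 n g : g + 3 <= n -> f n g <= 'C(n, 2).
Proof.
move=> g_le; have E : g <= n by lia.
have {}E := fE E; have Eg := bin2_double g.+1; have En := bin2_double n; nia.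
Qed.

Lemma f_le_isoperimetric n g k s : g + 3 <= n -> g < k <= n.+1 ->
  k * n < k + s + 'C(k, 2) -> f n g <= s.
Proof.
move=> g_le /andP[k_ge k_le] iso; have E : g <= n by lia.
have {}E := fE E; have Eg := bin2_double g.+1; have Ek := bin2_double k.
have [x Ex] : exists x, k = g.+1 + x by exists (k - g.+1); lia.
have [y Ey] : exists y, n.+1 = k + y by exists (n.+1 - k); lia.
have {}Ey : n = g + x + y by lia.
subst; nia.
Qed.

(** Here [k = n + 1] has to be excluded: for [g = n - 3] the symmetry of the
    isoperimetric bound about [n - 1/2] sends [g + 1] to [n + 1]. *)
Lemma f_lt_isoperimetric n g k s : g + 3 <= n -> g.+1 < k <= n ->
  k * n < k + s + 'C(k, 2) -> f n g < s.
Proof.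
move=> g_le /andP[k_ge k_le] iso; have E : g <= n by lia.
have {}E := fE E; have Eg := bin2_double g.+1; have Ek := bin2_double k.
have [x Ex] : exists x, k = g.+2 + x by exists (k - g.+2); lia.
have [y Ey] : exists y, n = k + y by exists (n - k); lia.
subst; nia.
Qed.

Lemma separation_bound n g (G : sgraph) (B C : {set G}) : HL_network n G ->
  g + 3 <= n -> detached B C -> g < #|B| -> g < #|C| ->
  f n g <= #|~: (B :|: C)|.
Proof.
move=> HG g_le BC B_gt C_gt; have CB := detached_sym BC.
have IB := detached_isoperimetry HG BC; have IC := detached_isoperimetry HG CB.
rewrite [C :|: B]setUC in IC.
case: (leqP #|B| n.+1) => [B_le|B_big].
  by apply: f_le_isoperimetric (IB _) => //; [rewrite B_gt | lia].
case: (leqP #|C| n.+1) => [C_le|C_big].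
  by apply: f_le_isoperimetric (IC _) => //; [rewrite C_gt | lia].
exact: leq_trans (f_le_bin2 g_le) (ltnW (small_separation HG BC B_big C_big)).
Qed.

Lemma expn2_gt_bin2_add3n n : 4 < n -> 'C(n, 2) + 3 * n < 2 ^ n + 4.
Proof.
elim: n => // n IH; rewrite ltnS leq_eqVlt => /orP[/eqP <- //|/[dup] n4 /IH].
by rewrite expnS (binS n) bin1; lia.
Qed.

(** [V] plays the role of a connected set whose neighbourhood [S] has [f n g]
    vertices, and [D] that of another component after deleting [S]. *)
Lemma small_piece n g (G : sgraph) (V D S : {set G}) : HL_network n G ->
  4 < n -> g + 3 <= n -> #|V| = g.+1 -> #|S| = f n g -> 0 < #|D| ->
  detached V D -> detached (V :|: D) (~: (S :|: (V :|: D))) ->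
  [disjoint S & V :|: D] -> g < #|D|.
Proof.
move=> HG n_gt4 g_le V_card S_card D0 VD sep dis; rewrite ltnNge; apply/negP => D_le.
have VD_card := detached_cardU VD.
have rest : ~: (V :|: D :|: ~: (S :|: (V :|: D))) = S.
  apply/setP => x; rewrite !inE negb_or negbK.
  have := disjointFr dis (x := x); rewrite !inE.
  by case: (x \in S) => [/(_ isT) ->|_] //=; case: (_ || _).
have f_le := f_le_bin2 g_le.
have iso := detached_isoperimetry HG sep; rewrite rest in iso.
have cardG := card_separation sep; rewrite rest (card_HL HG) in cardG.
have big_rest : n.+1 < #|~: (S :|: (V :|: D))|.
  by have := expn2_gt_bin2_add3n n_gt4; lia.
have VD_le : #|V :|: D| <= n.+1.
  rewrite leqNgt; apply/negP => VD_big.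
  by have := small_separation HG sep VD_big big_rest; rewrite rest; lia.
have VD_gt : g.+1 < #|V :|: D| by lia.
case: (ltnP n #|V :|: D|) => [VD_gtn|VD_len].
  (* The extreme case [#|V :|: D| = n + 1], where strictness is needed. *)
  have V0 : 0 < #|V| by lia.
  have := vertex_isoperimetry_detached HG VD V0 D0 VD_gtn.
  have := detached_closed_nbhd sep; rewrite rest.
  have -> : #|V :|: D| = n.+1 by lia.
  by rewrite binS bin1; have := bin2_double n; nia.
suff : f n g < #|S| by rewrite S_card ltnn.
by apply: f_lt_isoperimetric g_le _ (iso _); [rewrite VD_gt | lia].
Qed.

(** * Components after deleting vertices *)

Lemma connect_closed (G : sgraph) (B : {set G}) x y :
  (forall u v, u \in B -> adj u v -> v \in B) ->
  connect (@adj G) x y -> x \in B -> y \in B.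
Proof.
move=> closed_B /connectP[p + ->]; elim: p x => //= z p IH x /andP[xz pz] xB.
exact: IH pz (closed_B _ _ xB xz).
Qed.

Lemma HL_connected n (G : sgraph) : HL_network n G -> 2 < n -> connected G.
Proof.
move=> HG n_gt2; apply/forallP => x; apply/forallP => y.
apply/negPn/negP => nxy; pose B := [set z | connect (@adj G) x z].
have BC : detached B (~: B).
  move=> u v; rewrite !inE => xu nxv; apply/andP; split.
    by apply: contraNneq nxv => <-.
  by apply: contra nxv => uv; apply: connect_trans xu (connect1 uv).
have B0 : 0 < #|B| by rewrite card_gt0; apply/set0Pn; exists x; rewrite inE.
have C0 : 0 < #|~: B| by rewrite card_gt0; apply/set0Pn; exists y; rewrite !inE.
have := separation_bound HG (g := 0) n_gt2 BC B0 C0.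
by rewrite setUCr setCT cards0 /f mul0n; lia.
Qed.

Section Components.
Variables (G : sgraph) (S : {set G}).

(** Components of [del_verts S] live in a subtype; this is their image in [G],
    where the estimates on separations apply. *)
Definition component_verts (x : del_verts S) : {set G} :=
  [set val y | y in [set y | connect (@adj (del_verts S)) x y]].

Lemma card_component_verts x : #|component_verts x| =
  #|[set y | connect (@adj (del_verts S)) x y]|.
Proof. by rewrite card_imset //; exact: val_inj. Qed.

Lemma component_vertsP x y :
  reflect (exists2 z, connect (@adj (del_verts S)) x z & y = val z)
    (y \in component_verts x).
Proof.
apply: (iffP imsetP) => -[z xz ->]; exists z => //; first by rewrite inE in xz.
by rewrite inE.
Qed.

Lemma component_verts_disjoint x : [disjoint S & component_verts x].
Proof.
rewrite disjoint_sym disjoints_subset; apply/subsetP => _ /component_vertsP[z _ ->].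
by rewrite inE (valP z).
Qed.

Lemma component_verts_closed x u v :
  u \in component_verts x -> v \notin S -> adj u v -> v \in component_verts x.
Proof.
case/component_vertsP => z xz -> vS zv; apply/component_vertsP.
exists (Sub v vS) => //; apply: connect_trans xz (connect1 _).
exact: zv.
Qed.

Lemma component_verts_detached x :
  detached (component_verts x) (~: (S :|: component_verts x)).
Proof.
move=> u v uB; rewrite !inE negb_or => /andP[vS vB]; apply/andP; split.
  by apply: contraNneq vB => <-.
by apply: contra vB; exact: component_verts_closed.
Qed.

End Components.

(** * The two bounds *)

Lemma Rg_cutset_lower_bound n g (G : sgraph) (S : {set G}) :
  HL_network n G -> g + 3 <= n -> Rg_cutset g S -> f n g <= #|S|.
Proof.
move=> HG g_le /andP[/forallPn[x /forallPn[y nxy]] /forall_inP big].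
have big' (z : del_verts S) : g < #|component_verts z|.
  by rewrite card_component_verts -addn1; apply: big; exact: imset_f.
have sub : component_verts y \subset ~: (S :|: component_verts x).
  apply/subsetP => _ /component_vertsP[z yz ->].
  rewrite !inE (negbTE (valP z)) /=; apply/component_vertsP => -[t xt /val_inj E].
  move: nxy; rewrite (connect_trans xt) // -E.
  by rewrite sym_connect_sym // => u v; exact: adj_sym.
have := separation_bound HG g_le (@component_verts_detached _ _ x) (big' x)
  (leq_trans (big' y) (subset_leq_card sub)).
suff -> : ~: (component_verts x :|: ~: (S :|: component_verts x)) = S by [].
apply/setP => z; rewrite !inE negb_or negbK.
have := disjointFr (component_verts_disjoint x) (x := z).
by case: (z \in S) => [/(_ isT) ->|_] //=; case: (_ \in _).
Qed.

Lemma nbhd_Rg_cutset n g (G : sgraph) (A : subgraph G) : HL_network n G ->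
  4 < n -> g + 3 <= n -> connected (subgraph_graph A) ->
  #|sub_verts A| = g.+1 -> #|nbhd A| = f n g -> Rg_cutset g (nbhd A).
Proof.
move=> HG n_gt4 g_le Aconn A_card N_card.
set V := sub_verts A in A_card *; set S := nbhd A in N_card *.
have VS x : x \in V -> x \notin S by move=> xV; rewrite inE xV.
have V_closed u v : u \in V -> v \notin S -> adj u v -> v \in V.
  move=> uV; rewrite inE; case: (boolP (v \in V)) => //= _ /exists_inP no_nbr uv.
  by case: no_nbr; exists u; rewrite // adj_sym.
have stays (x y : del_verts S) :
    connect (@adj (del_verts S)) x y -> (val x \in V) = (val y \in V).
  have fwd u v : connect (@adj (del_verts S)) u v -> val u \in V -> val v \in V.
    move=> uv uV; have := @connect_closed _ [set z : del_verts S | val z \in V] u v.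
    rewrite !inE; apply => // s t; rewrite !inE => sV st.
    exact: V_closed sV (valP t) st.
  move=> xy; apply/idP/idP; apply: fwd => //.
  by rewrite sym_connect_sym // => u v; exact: adj_sym.
have f_le := f_le_bin2 g_le.
have [a aV] : exists a, a \in V by apply/set0Pn; rewrite -card_gt0 A_card.
have [e eVS] : exists e, e \in ~: (S :|: V).
  apply/set0Pn; rewrite -card_gt0; have := cardsC (S :|: V).
  have := expn2_gt_bin2_add3n n_gt4.
  by have := cardsU S V; rewrite (card_HL HG); lia.
move: eVS; rewrite in_setC in_setU negb_or => /andP[eS eV].
apply/andP; split.
  pose a' : del_verts S := Sub a (VS _ aV); pose e' : del_verts S := Sub e eS.
  by apply/negP => /forallP/(_ a')/forallP/(_ e')/stays; rewrite !SubK aV (negbTE eV).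
apply/forall_inP => _ /imsetP[x _ ->].
rewrite -card_component_verts addn1.
case: (boolP (val x \in V)) => [xV|xV].
  rewrite -A_card; apply: subset_leq_card; apply/subsetP => y yV.
  pose x' : subgraph_graph A := Sub (val x) xV.
  pose y' : subgraph_graph A := Sub y yV.
  have xy : connect (@adj (subgraph_graph A)) x' y'.
    by have /forallP/(_ x')/forallP/(_ y') := Aconn.
  have := @connect_closed _ [set z : subgraph_graph A | val z \in component_verts x] x' y'.
  rewrite !inE; apply => //.
    move=> u v; rewrite !inE => ux uv; apply: component_verts_closed ux _ _.
      exact: VS (valP v).
    by case/sub_adjP/and3P: uv.
  by apply/component_vertsP; exists x.
have outV y : y \in component_verts x -> y \notin V.
  by case/component_vertsP => z xz ->; rewrite -(stays _ _ xz).
apply: (@small_piece n g G V _ S) => //.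
- by rewrite card_gt0; apply/set0Pn; exists (val x); apply/component_vertsP; exists x.
- move=> u v uV vx; apply/andP; split.
    by apply: contraNneq (outV _ vx) => <-.
  apply: contra (outV _ vx) => uv; apply: V_closed uV _ uv.
  by rewrite (disjointFl (component_verts_disjoint x) vx).
- move=> u v uVx; rewrite in_setC !in_setU !negb_or => /and3P[vS vV vx].
  apply/andP; split.
    by apply: contraTneq uVx => ->; rewrite in_setU negb_or vV.
  apply/negP => uv; case/setUP: uVx => [uV|ux].
    by rewrite (V_closed u) in vV.
  by rewrite (component_verts_closed ux) in vx.
- rewrite disjoint_sym disjoints_subset; apply/subsetP => y.
  case/setUP => [/VS|yx]; rewrite in_setC //.
  by rewrite (disjointFl (component_verts_disjoint x) yx).
Qed.

Theorem theorem4p1 (n g : nat) (X : sgraph) (A : subgraph X)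
  (hn : 5 <= n) (hg : g <= n - 3) (hX : HL_network n X)
  (hconn : connected (subgraph_graph A))
  (hcard : #|sub_verts A| = g + 1)
  (hnbhd : #|nbhd A| = f n g) :
  extra_connectivity g X = Some (f n g).
Proof.
have g_le : g + 3 <= n by lia.
rewrite addn1 in hcard.
have cutA := nbhd_Rg_cutset hX hn g_le hconn hcard hnbhd.
have n_gt2 : 2 < n by lia.
rewrite /extra_connectivity (HL_connected hX n_gt2).
case: pickP => [S0 cut0|/(_ (nbhd A))]; last by rewrite cutA.
case: arg_minnP => // S cutS minS; congr Some; apply/eqP.
by rewrite eqn_leq (Rg_cutset_lower_bound hX g_le cutS) andbT -hnbhd minS.
Qed.
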